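(* Let $p,q\in\mathbb{R}$ with $p\ge0$, $q\ge0$, let $\lambda,\rho\in\mathbb{C}$ with $\Re(\rho)>-\frac12$, $\Re(\rho+\lambda)>-\frac12$ and $\Re(\rho-\lambda)>-\frac12$, and let $z\in\mathbb{C}\setminus(-\infty,0]$. Then for every integer $n\ge0$, $$\frac{d^n}{dz^n}\Big\{e^{\frac z2}z^{-\rho-\frac12}M_{p,q;\lambda,\rho}(z)\Big\}=\frac{(\rho-\lambda+\frac12)_n}{(2\rho+1)_n}\,e^{\frac z2}\,z^{-\rho-\frac n2-\frac12}\,M_{p,q;\lambda-\frac n2,\rho+\frac n2}(z).$$
   Context: $(a)_n=a(a+1)\cdots(a+n-1)$, $(a)_0=1$, is the Pochhammer symbol. $B(x,y)=\int_0^1 t^{x-1}(1-t)^{y-1}\,dt=\Gamma(x)\Gamma(y)/\Gamma(x+y)$ is the classical beta function ($\Re x,\Re y>0$). For real $p,q\ge0$ and $\Re x,\Re y>0$, the extended beta function is $$B_{p,q}(x,y)=\int_0^1 t^{x-1}(1-t)^{y-1}\exp\Big[-\frac pt-\frac q{1-t}\Big]\,dt.$$ The $(p,q)$-confluent hypergeometric function is, for $p,q\ge0$, $\Re(c)>\Re(b)>0$ and $z\in\mathbb{C}$, $$\Phi_{p,q}(b;c;z)=\sum_{n=0}^\infty\frac{B_{p,q}(b+n,c-b)}{B(b,c-b)}\frac{z^n}{n!}.$$ The $(p,q)$-Whittaker function is $$M_{p,q;\lambda,\rho}(z)=z^{\rho+\frac12}\exp\Big(-\frac z2\Big)\,\Phi_{p,q}\Big(\rho-\lambda+\frac12;2\rho+1;z\Big),$$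 defined for $p,q\ge0$, $\Re(\rho)>-\frac12$, $\Re(\rho\pm\lambda)>-\frac12$, $z\in\mathbb{C}\setminus(-\infty,0]$. All powers of $z$ are principal. *)

(* Defs.v *)
From Stdlib Require Export Reals Factorial.
From Coquelicot Require Export Coquelicot.
Local Open Scope C_scope.

Definition Cexp (z : C) : C := (exp (Re z) * cos (Im z), exp (Re z) * sin (Im z))%R.

(* Principal argument, with values in ]-PI, PI]; irrelevant value at z = 0. *)
Definition Carg (z : C) : R :=
  if Rle_dec 0 (Im z) then acos (Re z / Cmod z) else (- acos (Re z / Cmod z))%R.

Definition Clog (z : C) : C := (ln (Cmod z), Carg z).

(* Principal complex power z^a, as opposed to Coquelicot's natural power. *)
Definition Cpower (z a : C) : C := Cexp (a * Clog z).

Definition slit_plane (z : C) : Prop := ~ (Im z = 0%R /\ (Re z <= 0)%R).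

(* Sum of a complex series, unspecified when it diverges. *)
Definition CSeries (a : nat -> C) : C :=
  iota (fun s : C_CompleteNormedModule =>
          is_series (K := C_AbsRing) (V := C_NormedModule) a s).

(* l is the n-th complex derivative of f at z; in particular, the derivatives
   of lower order exist in a neighbourhood of z. *)
Fixpoint is_C_derive_n (f : C -> C) (n : nat) (z l : C) : Prop :=
  match n with
  | O => f z = l
  | S k => exists g : C -> C,
      locally (T := C_UniformSpace) z (fun w => is_C_derive_n f k w (g w)) /\
      is_derive (K := C_AbsRing) (V := C_NormedModule) g z l
  end.

Fixpoint pochhammer (a : C) (n : nat) : C :=
  match n with
  | O => 1
  | S k => pochhammer a k * (a + INR k)
  end.

Definition beta (x y : C) : C :=
  RInt_gen (V := C_R_CompleteNormedModule)
    (fun t : R => Cpower t (x - 1) * Cpower (1 - t)%R (y - 1))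
    (at_right 0%R) (at_left 1%R).

Definition ext_beta (p q : R) (x y : C) : C :=
  RInt_gen (V := C_R_CompleteNormedModule)
    (fun t : R => Cpower t (x - 1) * Cpower (1 - t)%R (y - 1) *
                  exp (- (p / t) - q / (1 - t))%R)
    (at_right 0%R) (at_left 1%R).

Definition Phi (p q : R) (b c z : C) : C :=
  CSeries (fun n : nat =>
    ext_beta p q (b + INR n) (c - b) / beta b (c - b) * (z ^ n / INR (fact n))).

Definition Whittaker (p q : R) (lambda rho z : C) : C :=
  Cpower z (rho + 1 / 2) * Cexp (- z / 2) *
  Phi p q (rho - lambda + 1 / 2) (2 * rho + 1) z.

(* Main.v *)
Require Import Defs.
From Stdlib Require Import FunctionalExtensionality Lra Lia.
Local Open Scope C_scope.

(* The powers and exponentials cancel, so the function to differentiate is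
   Phi(b; c; .) with b = rho - lambda + 1/2 and c = 2 rho + 1. Its Taylor
   coefficients are bounded, because B_{p,q}(b + n, c - b) is dominated by a real
   beta integral, so it is an exponential generating function that may be
   differentiated by shifting its coefficients. The shifted coefficients are those
   of Phi(b + n; c + n; .) up to the factor B(b + n, c - b) / B(b, c - b), which is
   (b)_n / (c)_n by the recurrence (x + y) B(x + 1, y) = x B(x, y). *)

(** * Complex series and exponential generating functions *)

Lemma is_Cseries_Cmod_le (a : nat -> C) (b : nat -> R) (s : C) (t : R) :
  (forall n, (Cmod (a n) <= b n)%R) ->
  is_series (K := C_AbsRing) (V := C_NormedModule) a s -> is_series b t ->
  (Cmod s <= t)%R.
Proof.
intros Hab Ha Hb.
apply (is_lim_seq_le
  (fun n => norm (sum_n (G := C_NormedModule) a n)) (sum_n b) (Cmod s) t).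
- intros n. eapply Rle_trans. apply norm_sum_n_m.
  apply sum_n_m_le. exact Hab.
- eapply filterlim_comp. exact Ha. apply (filterlim_norm (V := C_NormedModule)).
- exact Hb.
Qed.

Lemma CSeries_unique (a : nat -> C) (s : C) :
  is_series (K := C_AbsRing) (V := C_NormedModule) a s -> CSeries a = s.
Proof.
intros H. apply (iota_filterlim_locally (V := C_CompleteNormedModule)).
exact H.
Qed.

(** [Phi p q b c] is convertible to this function for its coefficient sequence, so the results on it
    transfer to [Phi] directly. *)
Definition exp_gen_fun (a : nat -> C) (z : C) : C :=
  CSeries (fun n => a n * (z ^ n / INR (fact n))).

Lemma Cmod_INR (n : nat) : Cmod (INR n) = INR n.
Proof. rewrite Cmod_R. apply Rabs_pos_eq, pos_INR. Qed.

Lemma INR_fact_neq_0C (n : nat) : RtoC (INR (fact n)) <> 0.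
Proof. intros H. apply (INR_fact_neq_0 n), RtoC_inj, H. Qed.

Lemma is_series_exp (x : R) : is_series (fun n => x ^ n / INR (fact n))%R (exp x).
Proof.
eapply is_series_ext. 2: exact (is_exp_Reals x).
intros n. unfold scal; simpl; unfold mult; simpl. rewrite pow_n_pow. reflexivity.
Qed.

Lemma is_series_Rmult_l (c : R) (a : nat -> R) (l : R) :
  is_series a l -> is_series (fun n => c * a n)%R (c * l)%R.
Proof. exact (is_series_scal c a l). Qed.

(** The terms are dominated by [K] times those of the series of [exp (Cmod z)]. *)
Lemma is_series_exp_gen_fun (a : nat -> C) (K : R) (z : C) :
  (forall n, (Cmod (a n) <= K)%R) ->
  is_series (K := C_AbsRing) (V := C_NormedModule)
    (fun n => a n * (z ^ n / INR (fact n))) (exp_gen_fun a z).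
Proof.
intros Ha.
destruct (ex_series_le (K := C_AbsRing) (V := C_CompleteNormedModule)
  (fun n => a n * (z ^ n / INR (fact n)))
  (fun n => K * (Cmod z ^ n / INR (fact n)))%R) as [s Hs].
- intros n. change (Cmod (a n * (z ^ n / INR (fact n)))
    <= K * (Cmod z ^ n / INR (fact n)))%R.
  rewrite Cmod_mult, Cmod_div, Cmod_pow, Cmod_INR by apply INR_fact_neq_0C.
  apply Rmult_le_compat_r. 2: apply Ha.
  apply Rdiv_le_0_compat. apply pow_le, Cmod_ge_0. apply INR_fact_lt_0.
- eexists. apply is_series_Rmult_l, is_series_exp.
- unfold exp_gen_fun. rewrite (CSeries_unique _ s); exact Hs.
Qed.

(* The crude factor [2 ^ n] keeps the remainder of the form needed to sum to [exp (2 * M)]. *)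
Lemma Cpow_taylor2 (z h : C) (M : R) (n : nat) :
  (1 <= M)%R -> (Cmod z <= M)%R -> (Cmod (z + h) <= M)%R ->
  (Cmod ((z + h) ^ S n - z ^ S n - INR (S n) * h * z ^ n)
    <= Cmod h ^ 2 * (INR (S n) * (2 * M) ^ n))%R.
Proof.
intros HM Hz Hzh.
pose proof (Cmod_ge_0 h) as Hh0.
induction n as [|n IH].
- replace (_ - _ - _) with (RtoC 0) by (simpl; ring).
  rewrite Cmod_0. simpl. nra.
(* With R_n = (z+h)^(n+1) - z^(n+1) - (n+1) h z^n, the induction rests on R_(n+1) = (z+h) R_n +
   (n+1) h^2 z^n. *)
- replace (_ - _ - _) with
    ((z + h) * ((z + h) ^ S n - z ^ S n - INR (S n) * h * z ^ n)
      + INR (S n) * (h * h) * z ^ n)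
    by (rewrite (S_INR (S n)), RtoC_plus; simpl; ring).
  eapply Rle_trans. apply Cmod_triangle.
  rewrite !Cmod_mult, Cmod_pow, Cmod_INR.
  set (A := Cmod (_ - _)) in *.
  assert (H1 : (Cmod z ^ n <= M ^ n)%R)
    by (apply pow_incr; split; [apply Cmod_ge_0 | exact Hz]).
  assert (H2 : (1 <= 2 ^ n)%R) by (apply pow_R1_Rle; lra).
  assert (H3 : (0 < M ^ n)%R) by (apply pow_lt; lra).
  pose proof (pos_INR (S n)) as HN.
  rewrite (S_INR (S n)).
  rewrite Rpow_mult_distr in IH.
  replace ((2 * M) ^ S n)%R with (2 * M * (2 ^ n * M ^ n))%R
    by (rewrite Rpow_mult_distr; simpl; ring).
  set (N := INR (S n)) in *.
  set (H := Cmod h) in *.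
  (* Both summands get the same bound, using [1 <= M] for the second one. Together they make
     [H ^ 2 * (N * (2 * M) ^ S n)], below the target with [N + 1]. *)
  apply Rle_trans with (M * (H ^ 2 * (N * (2 ^ n * M ^ n)))
    + N * (H * H) * (M * (2 ^ n * M ^ n)))%R.
  + apply Rplus_le_compat.
    * apply Rmult_le_compat; try apply Cmod_ge_0; assumption.
    * apply Rmult_le_compat_l. nra.
      eapply Rle_trans. exact H1.
      assert (1 <= M * 2 ^ n)%R by nra. nra.
  + assert (0 <= H ^ 2 * (M * (2 ^ n * M ^ n)))%R.
    { apply Rmult_le_pos. nra. apply Rmult_le_pos. lra. nra. }
    nra.
Qed.

Lemma locally_C_Cmod (z : C) (P : C -> Prop) (d : R) :
  (0 < d)%R -> (forall w, (Cmod (w - z) < d)%R -> P w) ->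
  locally (T := AbsRing_UniformSpace C_AbsRing) z P.
Proof. intros Hd H. exists (mkposreal d Hd). intros w Hw. apply H, Hw. Qed.

(** Summing the second-order Taylor remainders of the powers gives a remainder of at most
    [Cmod h ^ 2 * L] for [Cmod h <= 1]. A quadratic error identifies the derivative. *)
Lemma is_derive_exp_gen_fun (a : nat -> C) (K : R) (z : C) :
  (forall n, (Cmod (a n) <= K)%R) ->
  is_derive (K := C_AbsRing) (V := C_NormedModule) (exp_gen_fun a) z
    (exp_gen_fun (fun n => a (S n)) z).
Proof.
intros Ha.
assert (HK : (0 <= K)%R) by (eapply Rle_trans; [apply Cmod_ge_0 | apply (Ha O)]).
(* [M] is at least 1 and bounds the moduli of [z] and of [z + h] when [Cmod h <= 1]. *)
set (M := (Cmod z + 1)%R).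
pose proof (Cmod_ge_0 z) as Hz0.
set (L := (K * exp (2 * M))%R).
assert (HL : (0 <= L)%R) by (apply Rmult_le_pos; [exact HK | left; apply exp_pos]).
assert (Hmain : forall h, (Cmod h <= 1)%R ->
  (Cmod (exp_gen_fun a (z + h) - exp_gen_fun a z - h * exp_gen_fun (fun n => a (S n)) z)
    <= Cmod h ^ 2 * L)%R).
{ intros h Hh.
  (* The sum runs over the indices [S n] because [a 0] cancels in the difference; the factor
     [INR (S n)] reduces the factorial of [S n] to that of [n]. *)
  apply is_Cseries_Cmod_le with
    (a := fun n => a (S n) * (((z + h) ^ S n - z ^ S n - INR (S n) * h * z ^ n)
      / INR (fact (S n))))
    (b := fun n => (Cmod h ^ 2 * (K * ((2 * M) ^ n / INR (fact n))))%R).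
  - intros n.
    rewrite Cmod_mult, Cmod_div, Cmod_INR by apply INR_fact_neq_0C.
    assert (HT := Cpow_taylor2 z h M n ltac:(unfold M; lra) ltac:(unfold M; lra)
      ltac:(unfold M; eapply Rle_trans; [apply Cmod_triangle | lra])).
    replace (Cmod h ^ 2 * _)%R with
      (K * ((Cmod h ^ 2 * (INR (S n) * (2 * M) ^ n)) / INR (fact (S n))))%R.
    + apply Rmult_le_compat; try apply Cmod_ge_0; try apply Ha.
      * apply Rdiv_le_0_compat. apply Cmod_ge_0. apply INR_fact_lt_0.
      * apply Rmult_le_compat_r. left. apply Rinv_0_lt_compat, INR_fact_lt_0.
        exact HT.
    + rewrite fact_simpl, mult_INR. field. split.
      apply INR_fact_neq_0. now apply not_0_INR.
  - set (Fz := exp_gen_fun a z). set (Fw := exp_gen_fun a (z + h)).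
    set (Fd := exp_gen_fun (fun n => a (S n)) z).
    assert (Hs : forall w, is_series (K := C_AbsRing) (V := C_NormedModule)
      (fun n => a (S n) * (w ^ S n / INR (fact (S n)))) (exp_gen_fun a w - a O)).
    { intros w.
      apply (is_series_incr_1 (V := C_NormedModule)
        (fun n => a n * (w ^ n / INR (fact n)))).
      replace (plus _ _) with (exp_gen_fun a w). apply (is_series_exp_gen_fun a K w Ha).
      change (exp_gen_fun a w = exp_gen_fun a w - a O + a O * (1 / RtoC 1)). field. }
    assert (Hd := is_series_exp_gen_fun (fun n => a (S n)) K z (fun n => Ha (S n))).
    apply (is_series_scal (K := C_AbsRing) (V := C_NormedModule) h) in Hd.
    assert (H := is_series_minus (V := C_NormedModule) _ _ _ _
      (is_series_minus (V := C_NormedModule) _ _ _ _ (Hs (z + h)) (Hs z)) Hd).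
    replace (Fw - Fz - h * Fd) with (minus (G := C_NormedModule)
      (minus (G := C_NormedModule) (exp_gen_fun a (z + h) - a O) (exp_gen_fun a z - a O))
      (scal (V := C_NormedModule) h Fd)).
    + eapply is_series_ext. 2: exact H.
      intros n.
      change ((a (S n) * ((z + h) ^ S n / INR (fact (S n)))
        - a (S n) * (z ^ S n / INR (fact (S n)))
        - h * (a (S n) * (z ^ n / INR (fact n)))
        = a (S n) * (((z + h) ^ S n - z ^ S n - INR (S n) * h * z ^ n)
      / INR (fact (S n))))).
      rewrite fact_simpl, mult_INR, RtoC_mult. field. split.
      apply INR_fact_neq_0C. intros E. apply RtoC_inj in E. revert E. now apply not_0_INR.
    + change ((Fw - a O) - (Fz - a O) - h * Fd = Fw - Fz - h * Fd). ring.
  - apply is_series_Rmult_l, is_series_Rmult_l, is_series_exp. }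
split.
- apply (is_linear_scal_l (K := C_AbsRing) (V := C_NormedModule)).
- intros x Hx. apply (is_filter_lim_locally_unique
    (V := AbsRing_NormedModule C_AbsRing) z x) in Hx. subst x.
  intros eps.
  (* Within radius 1 [Hmain] applies; within [eps / (L + 1)] its quadratic bound is at most
     [eps * Cmod (w - z)]. The [+ 1] covers [L = 0]. *)
  apply locally_C_Cmod with (Rmin 1 (eps / (L + 1))).
  + apply Rmin_glb_lt. lra. apply Rdiv_lt_0_compat. apply cond_pos. lra.
  + intros w Hw.
    change (Cmod (exp_gen_fun a w - exp_gen_fun a z - (w - z) * exp_gen_fun (fun n => a (S n)) z)
      <= eps * Cmod (w - z))%R.
    assert (H1 := Rlt_le_trans _ _ _ Hw (Rmin_l _ _)).
    assert (H2 := Rlt_le_trans _ _ _ Hw (Rmin_r _ _)).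
    assert (H := Hmain (w - z) ltac:(lra)).
    replace (z + (w - z)) with w in H by ring.
    eapply Rle_trans. exact H.
    set (D := Cmod (w - z)) in *.
    assert (0 <= D)%R by apply Cmod_ge_0.
    apply (Rmult_lt_compat_r (L + 1)) in H2. 2: lra.
    unfold Rdiv in H2. rewrite Rmult_assoc, Rinv_l, Rmult_1_r in H2 by lra.
    nra.
Qed.

Lemma is_C_derive_n_exp_gen_fun (a : nat -> C) (K : R) (n : nat) (z : C) :
  (forall k, (Cmod (a k) <= K)%R) ->
  is_C_derive_n (exp_gen_fun a) n z (exp_gen_fun (fun k => a (n + k)%nat) z).
Proof.
intros Ha. revert z. induction n as [|n IH]; intros z.
- reflexivity.
- exists (exp_gen_fun (fun k => a (n + k)%nat)). split.
  + apply filter_forall. exact IH.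
  + replace (exp_gen_fun (fun k => a (S n + k)%nat) z)
      with (exp_gen_fun (fun k => a (n + S k)%nat) z).
    * apply (is_derive_exp_gen_fun (fun k => a (n + k)%nat) K). intros k. apply Ha.
    * f_equal. apply functional_extensionality. intros k. f_equal. lia.
Qed.

(** * Improper integrals over an open interval *)

Local Open Scope R_scope.

Lemma at_right_Ioo (a b : R) : a < b -> at_right a (fun t => a < t < b).
Proof.
intros H. exists (mkposreal (b - a) ltac:(lra)). intros t Ht Hat.
apply Rabs_def2 in Ht. simpl in Ht. unfold minus, plus, opp in Ht; simpl in Ht. lra.
Qed.

Lemma at_left_Ioo (a b : R) : a < b -> at_left b (fun t => a < t < b).
Proof.
intros H. exists (mkposreal (b - a) ltac:(lra)). intros t Ht Hat.
apply Rabs_def2 in Ht. simpl in Ht. unfold minus, plus, opp in Ht; simpl in Ht. lra.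
Qed.

Lemma Rmin_Rmax_Ioo (a b s t x : R) :
  a < s < b -> a < t < b -> Rmin s t <= x <= Rmax s t -> a < x < b.
Proof. unfold Rmin, Rmax. destruct Rle_dec; lra. Qed.

Section FundamentalTheorem.

Context {V : CompleteNormedModule R_AbsRing}.
Variables a b : R.
Hypothesis Hab : a < b.

(** The ordinary fundamental theorem applies between interior points; one-sided limits then take the
    place of values of [F] at [a] and [b]. *)
Lemma is_RInt_gen_derive_Ioo (F f : R -> V) (la lb : V) :
  (forall t, a < t < b -> is_derive F t (f t)) ->
  (forall t, a < t < b -> continuous f t) ->
  filterlim F (at_right a) (locally la) ->
  filterlim F (at_left b) (locally lb) ->
  is_RInt_gen f (at_right a) (at_left b) (minus lb la).
Proof.
intros HF Hf Ha Hb.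
apply filterlimi_lim_ext_loc with (f := fun ab => minus (F (snd ab)) (F (fst ab))).
- apply (Filter_prod _ _ _ _ _ (at_right_Ioo a b Hab) (at_left_Ioo a b Hab)).
  intros s t Hs Ht.
  apply (is_RInt_derive (V := V) F f); intros x Hx; [apply HF | apply Hf];
    exact (Rmin_Rmax_Ioo a b s t x Hs Ht Hx).
- unfold minus.
  apply (filterlim_comp_2 (G := locally lb) (H := locally (opp la))
    (fun ab : R * R => F (snd ab)) (fun ab : R * R => opp (F (fst ab)))).
  + eapply filterlim_comp. apply filterlim_snd. exact Hb.
  + eapply filterlim_comp. 2: apply (filterlim_opp (K := R_AbsRing) (V := V)).
    eapply filterlim_comp. apply filterlim_fst. exact Ha.
  + apply (filterlim_plus (K := R_AbsRing) (V := V)).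
Qed.

End FundamentalTheorem.

Lemma minus_plus_mid {G : AbelianGroup} (x y z : G) :
  minus (plus (plus x y) z) y = plus x z.
Proof.
unfold minus. rewrite <- (plus_assoc x y z), (plus_comm y z).
now rewrite (plus_assoc x z y), <- (plus_assoc (plus x z)), plus_opp_r, plus_zero_r.
Qed.

Section Domination.

Context {V : CompleteNormedModule R_AbsRing}.
Variables a b : R.
Hypothesis Hab : a < b.
Variables (f : R -> V) (G g : R -> R) (la lb : R).
Hypothesis Hf : forall t, a < t < b -> continuous f t.
Hypothesis Hfg : forall t, a < t < b -> norm (f t) <= g t.
Hypothesis HG : forall t, a < t < b -> is_derive G t (g t).
Hypothesis Hg : forall t, a < t < b -> continuous g t.
Hypothesis Ha : filterlim G (at_right a) (locally la).
Hypothesis Hb : filterlim G (at_left b) (locally lb).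

(** The absolute value allows either order of [s] and [t]; the Cauchy estimate in the next lemma
    compares end points in unknown order. *)
Lemma norm_RInt_le_primitive (s t : R) (l : V) :
  a < s < b -> a < t < b -> is_RInt f s t l -> norm l <= Rabs (G t - G s).
Proof.
assert (Hle : forall s t l, a < s < b -> a < t < b -> s <= t -> is_RInt f s t l ->
  norm l <= Rabs (G t - G s)).
{ clear s t l. intros s t l Hs Ht Hst Hl.
  eapply Rle_trans. 2: apply Rle_abs.
  apply (norm_RInt_le f g s t l (G t - G s) Hst).
  - intros x Hx. apply Hfg. lra.
  - exact Hl.
  - apply (is_RInt_derive (V := R_CompleteNormedModule) G g);
      intros x Hx; [apply HG | apply Hg];
      exact (Rmin_Rmax_Ioo a b s t x Hs Ht Hx). }
intros Hs Ht Hl.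
destruct (Rle_dec s t) as [Hst|Hst].
- now apply Hle.
- rewrite <- norm_opp, Rabs_minus_sym. apply Hle; try assumption. lra.
  now apply is_RInt_swap.
Qed.

(** Cauchy criterion: two integrals differ by one piece near each end, each bounded by an increment
    of [G], which is small because [G] has limits there. Comparison with the integral of [g] then
    bounds the norm. *)
Lemma is_RInt_gen_dominated :
  exists l : V, is_RInt_gen f (at_right a) (at_left b) l /\ norm l <= lb - la.
Proof.
assert (Hex : forall s t, a < s < b -> a < t < b -> exists l, is_RInt f s t l).
{ intros s t Hs Ht. apply (ex_RInt_continuous (V := V)).
  intros x Hx. apply Hf. exact (Rmin_Rmax_Ioo a b s t x Hs Ht Hx). }
destruct (proj1 (filterlimi_locally_cauchy
  (F := filter_prod (at_right a) (at_left b)) (U := V)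
  (fun ab l => is_RInt f (fst ab) (snd ab) l)
  ltac:(apply (Filter_prod _ _ _ _ _ (at_right_Ioo a b Hab) (at_left_Ioo a b Hab));
    intros s t Hs Ht; split;
    [ now apply Hex
    | intros y1 y2 H1 H2;
      rewrite <- (is_RInt_unique (V := V) f _ _ _ H1);
      apply (is_RInt_unique (V := V) f _ _ _ H2) ]))) as [l Hl].
- intros eps.
  (* Two values of [G] within [eps / 4] of the same limit differ by less than [eps / 2], and there
     are two end pieces. *)
  set (e := mkposreal (eps / 4) ltac:(generalize (cond_pos eps); lra)).
  exists (fun u => (a < fst u < b /\ Rabs (G (fst u) - la) < e)
    /\ (a < snd u < b /\ Rabs (G (snd u) - lb) < e)).
  split.
  + apply (Filter_prod _ _ _
      (fun s => a < s < b /\ Rabs (G s - la) < e)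
      (fun t => a < t < b /\ Rabs (G t - lb) < e)).
    * apply filter_and. now apply at_right_Ioo.
      apply (Ha (fun y => Rabs (y - la) < e)). exists e. intros y Hy. exact Hy.
    * apply filter_and. now apply at_left_Ioo.
      apply (Hb (fun y => Rabs (y - lb) < e)). exists e. intros y Hy. exact Hy.
    * intros s t Hs Ht. now split.
  + intros [s t] [s' t'] [[Hs1 Hs2] [Ht1 Ht2]] [[Hs1' Hs2'] [Ht1' Ht2']] u v Hu Hv.
    simpl in *.
    apply (norm_compat1 (V := V)).
    destruct (Hex s' s Hs1' Hs1) as [l1 H1].
    destruct (Hex t t' Ht1 Ht1') as [l2 H2].
    (* Going from [s'] to [t'] through [s] and [t] gives [v = l1 + u + l2], so [v - u] consists of
       the end pieces only. *)
    assert (E := is_RInt_Chasles _ _ _ _ _ _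
      (is_RInt_Chasles _ _ _ _ _ _ H1 Hu) H2).
    assert (E' : v = plus (plus l1 u) l2).
    { transitivity (RInt (V := V) f s' t').
      - symmetry. apply (is_RInt_unique (V := V) f _ _ _ Hv).
      - apply (is_RInt_unique (V := V) f _ _ _ E). }
    assert (Hn : norm (minus v u) <= norm l1 + norm l2).
    { rewrite E'. assert (E'' := minus_plus_mid (G := V) l1 u l2).
      eapply Rle_trans. right. exact (f_equal norm E'').
      exact (norm_triangle l1 l2). }
    apply (Rle_lt_trans _ _ _ Hn).
    apply norm_RInt_le_primitive in H1; try assumption.
    apply norm_RInt_le_primitive in H2; try assumption.
    unfold e in *; simpl in *.
    apply Rabs_def2 in Hs2, Ht2, Hs2', Ht2'.
    assert (Rabs (G s - G s') < eps / 2) by (apply Rabs_def1; lra).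
    assert (Rabs (G t' - G t) < eps / 2) by (apply Rabs_def1; lra).
    assert (Hs := Rplus_le_compat _ _ _ _ H1 H2).
    apply (Rle_lt_trans _ _ _ Hs). lra.
- exists l. split. exact Hl.
  apply (RInt_gen_norm (Fa := at_right a) (Fb := at_left b) f g l (lb - la)).
  (* Separating the end points by the midpoint guarantees [s <= t]. *)
  + apply (Filter_prod _ _ _ (fun t => a < t < (a + b) / 2)
      (fun t => (a + b) / 2 < t < b)).
    * apply at_right_Ioo. lra.
    * apply at_left_Ioo. lra.
    * intros s t Hs Ht. simpl. lra.
  + apply (Filter_prod _ _ _ _ _ (at_right_Ioo a b Hab) (at_left_Ioo a b Hab)).
    intros s t Hs Ht x Hx. apply Hfg. simpl in Hx. lra.
  + exact Hl.
  + apply (is_RInt_gen_derive_Ioo (V := R_CompleteNormedModule) a b Hab G g la lb);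
      assumption.
Qed.

End Domination.

(** * Complex-valued calculus, complex exponential and powers *)

Local Open Scope C_scope.

Lemma is_C_R_derive_pair (u v : R -> R) (t du dv : R) :
  is_derive u t du -> is_derive v t dv ->
  is_derive (V := C_R_NormedModule) (fun s => (u s, v s)) t (du, dv).
Proof.
intros Hu Hv.
assert (H := is_derive_plus (V := C_R_NormedModule) _ _ _ _ _
  (is_derive_scal_l (V := C_R_NormedModule) u t du (RtoC 1) Hu)
  (is_derive_scal_l (V := C_R_NormedModule) v t dv Ci Hv)).
replace (du, dv) with (plus (G := C_R_NormedModule)
  (scal (V := C_R_NormedModule) du (RtoC 1)) (scal (V := C_R_NormedModule) dv Ci)).
- eapply is_derive_ext. 2: exact H.
  intros s. apply injective_projections; simpl;
    unfold plus, scal; simpl; unfold mult; simpl; ring.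
- apply injective_projections; simpl;
    unfold plus, scal; simpl; unfold mult; simpl; ring.
Qed.

(** The integral here is linear over the reals; a complex factor mixes the two components, which are
    therefore integrated separately. *)
Lemma is_RInt_Cmult (c l : C) (f : R -> C) (a b : R) :
  is_RInt (V := C_R_NormedModule) f a b l ->
  is_RInt (V := C_R_NormedModule) (fun t => c * f t) a b (c * l).
Proof.
intros H.
assert (H1 := is_RInt_fct_extend_fst (U := R_NormedModule) (V := R_NormedModule) _ _ _ _ H).
assert (H2 := is_RInt_fct_extend_snd (U := R_NormedModule) (V := R_NormedModule) _ _ _ _ H).
apply (is_RInt_fct_extend_pair (U := R_NormedModule) (V := R_NormedModule)).
- exact (is_RInt_minus _ _ _ _ _ _ (is_RInt_scal _ _ _ (fst c) _ H1)
    (is_RInt_scal _ _ _ (snd c) _ H2)).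
- exact (is_RInt_plus _ _ _ _ _ _ (is_RInt_scal _ _ _ (fst c) _ H2)
    (is_RInt_scal _ _ _ (snd c) _ H1)).
Qed.

Lemma is_RInt_gen_Cmult (c l : C) (f : R -> C) (Fa Fb : (R -> Prop) -> Prop)
    {FFa : Filter Fa} {FFb : Filter Fb} :
  is_RInt_gen (V := C_R_NormedModule) f Fa Fb l ->
  is_RInt_gen (V := C_R_NormedModule) (fun t => c * f t) Fa Fb (c * l).
Proof.
intros H P HP.
assert (Hc : locally (T := C_UniformSpace) l (fun y => P (c * y))).
{ exact (filterlim_scal_r (K := C_AbsRing) (V := C_NormedModule) c l P HP). }
assert (H' := H _ Hc).
unfold filtermapi in *.
generalize H'. apply filter_imp.
intros ab [y [Hy HPy]]. exists (c * y). split. now apply is_RInt_Cmult. exact HPy.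
Qed.

Lemma Cmod_Cexp (z : C) : Cmod (Cexp z) = exp (Re z).
Proof.
unfold Cexp, Cmod; simpl.
replace (_ + _)%R with (exp (Re z) * exp (Re z) * (Rsqr (sin (Im z)) + Rsqr (cos (Im z))))%R
  by (unfold Rsqr; ring).
rewrite sin2_cos2, Rmult_1_r. apply sqrt_square. left; apply exp_pos.
Qed.

Lemma Cexp_plus (a b : C) : Cexp (a + b) = Cexp a * Cexp b.
Proof.
destruct a as [a1 a2], b as [b1 b2].
unfold Cexp, Cmult, Cplus; simpl. rewrite exp_plus, cos_plus, sin_plus.
apply injective_projections; simpl; ring.
Qed.

Lemma Cexp_0 : Cexp 0 = 1.
Proof. unfold Cexp; simpl. rewrite exp_0, cos_0, sin_0. apply injective_projections; simpl; ring. Qed.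

Lemma Clog_pos (t : R) : (0 < t)%R -> Clog t = RtoC (ln t).
Proof.
intros Ht. unfold Clog, Carg. rewrite Cmod_R, Rabs_pos_eq by lra. simpl.
destruct (Rle_dec 0 0) as [_|H]; [|lra].
unfold Rdiv. rewrite Rinv_r, acos_1 by lra. reflexivity.
Qed.

Lemma Cpower_pos (t : R) (a : C) : (0 < t)%R -> Cpower t a = Cexp (a * ln t).
Proof. intros Ht. unfold Cpower. now rewrite Clog_pos. Qed.

(** Both powers use the same [Clog z], so no branch question arises. *)
Lemma Cpower_plus (z a b : C) : Cpower z (a + b) = Cpower z a * Cpower z b.
Proof. unfold Cpower. now rewrite Cmult_plus_distr_r, Cexp_plus. Qed.

Lemma Cpower_0 (z : C) : Cpower z 0 = 1.
Proof. unfold Cpower. now rewrite Cmult_0_l, Cexp_0. Qed.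

(** * The integrand of the extended beta function *)

Section BetaKernel.

Variables (p q : R) (x y : C).

(* [beta_kernel p q x y t] is t^x (1-t)^y exp(-p/t - q/(1-t)), in coordinates so
   that its derivative reduces to real calculus. *)
Definition beta_modulus (t : R) : R :=
  exp (Re x * ln t + Re y * ln (1 - t) - p / t - q / (1 - t)).

Definition beta_phase (t : R) : R := (Im x * ln t + Im y * ln (1 - t))%R.

Definition beta_kernel (t : R) : C :=
  (beta_modulus t * cos (beta_phase t), beta_modulus t * sin (beta_phase t))%R.

Lemma beta_kernel_Cexp (t : R) :
  beta_kernel t =
  Cexp (x * ln t + y * ln (1 - t) + RtoC (- (p / t) - q / (1 - t))).
Proof.
unfold beta_kernel, beta_modulus, beta_phase, Cexp; simpl.
apply injective_projections; simpl; f_equal; f_equal; unfold Re, Im; ring.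
Qed.

Lemma Cmod_beta_kernel (t : R) : Cmod (beta_kernel t) = beta_modulus t.
Proof.
rewrite beta_kernel_Cexp, Cmod_Cexp. unfold beta_modulus. f_equal.
unfold Re; simpl. unfold Re, Im. ring.
Qed.

(** The factor in front of the kernel is its logarithmic derivative. *)
Lemma is_derive_beta_kernel (t : R) : (0 < t < 1)%R ->
  is_derive (V := C_R_NormedModule) beta_kernel t
    ((x / t - y / (1 - t)%R + RtoC (p / t ^ 2 - q / (1 - t) ^ 2)%R)
      * beta_kernel t).
Proof.
intros Ht.
replace (_ * beta_kernel t) with
  (((Re x / t - Re y / (1 - t) + (p / t ^ 2 - q / (1 - t) ^ 2))
      * (beta_modulus t * cos (beta_phase t))
    - (Im x / t - Im y / (1 - t)) * (beta_modulus t * sin (beta_phase t)))%R,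
   ((Re x / t - Re y / (1 - t) + (p / t ^ 2 - q / (1 - t) ^ 2))
      * (beta_modulus t * sin (beta_phase t))
    + (Im x / t - Im y / (1 - t)) * (beta_modulus t * cos (beta_phase t)))%R).
- apply is_C_R_derive_pair; unfold beta_modulus, beta_phase; auto_derive.
  1, 3: repeat split; lra.
  + unfold Rdiv, Rminus. field. lra.
  + unfold Rdiv, Rminus. field. lra.
- unfold Cdiv. rewrite <- !RtoC_inv by lra.
  unfold beta_kernel, Re, Im. apply injective_projections; simpl; field; lra.
Qed.

Lemma continuous_beta_kernel (t : R) : (0 < t < 1)%R ->
  continuous (T := R_UniformSpace) (U := C_UniformSpace) beta_kernel t.
Proof.
intros Ht.
apply (ex_derive_continuous (K := R_AbsRing) (V := C_R_NormedModule)).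
eexists. now apply is_derive_beta_kernel.
Qed.

End BetaKernel.

Lemma ext_beta_integrand (p q : R) (x y : C) (t : R) : (0 < t < 1)%R ->
  Cpower t (x - 1) * Cpower (1 - t)%R (y - 1) * exp (- (p / t) - q / (1 - t))%R
  = beta_kernel p q (x - 1) (y - 1) t.
Proof.
intros Ht. rewrite beta_kernel_Cexp, !Cexp_plus, !Cpower_pos by lra.
f_equal. unfold Cexp; simpl. rewrite cos_0, sin_0.
apply injective_projections; simpl; ring.
Qed.

(** * Convergence and bounds of the extended beta integral *)

Lemma exp_le_exp (u v : R) : (u <= v)%R -> (exp u <= exp v)%R.
Proof.
intros [H| ->]. left. now apply exp_increasing. apply Rle_refl.
Qed.

(** The exponential damping is at most 1, and lowering the exponent of [t] to [al] only enlarges the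
    power. On each half of ]0, 1[ one of [t], [1 - t] is at least 1/2, so its power is bounded by a
    power of 2. The sum separates the two singularities and has an elementary primitive. *)
Lemma beta_modulus_le (p q : R) (x y : C) (al : R) (t : R) :
  (0 <= p)%R -> (0 <= q)%R -> (al <= Re x)%R -> (0 < t < 1)%R ->
  (beta_modulus p q x y t <=
   exp ((Rabs al + Rabs (Re y)) * ln 2)
   * (exp (al * ln t) + exp (Re y * ln (1 - t))))%R.
Proof.
intros Hp Hq Hx Ht.
set (be := Re y).
assert (Hln1 : (ln t < 0)%R) by (rewrite <- ln_1; apply ln_increasing; lra).
assert (Hln2 : (ln (1 - t) < 0)%R) by (rewrite <- ln_1; apply ln_increasing; lra).
assert (Hpt : (0 <= p / t)%R) by (apply Rdiv_le_0_compat; lra).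
assert (Hqt : (0 <= q / (1 - t))%R) by (apply Rdiv_le_0_compat; lra).
assert (H0 : (beta_modulus p q x y t <= exp (al * ln t + be * ln (1 - t)))%R).
{ apply exp_le_exp. fold be. nra. }
eapply Rle_trans. exact H0.
rewrite Rmult_plus_distr_l, <- !exp_plus.
pose proof (exp_pos ((Rabs al + Rabs be) * ln 2 + al * ln t)) as E1.
pose proof (exp_pos ((Rabs al + Rabs be) * ln 2 + be * ln (1 - t))) as E2.
assert (Hl2 : (0 < ln 2)%R) by (rewrite <- ln_1; apply ln_increasing; lra).
assert (Hln : forall s, (1 / 2 <= s)%R -> (- ln 2 <= ln s)%R).
{ intros s Hs. rewrite <- ln_Rinv by lra. apply ln_le; lra. }
pose proof (Rabs_pos al). pose proof (Rabs_pos be).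
assert (Hmul : forall c l, (- ln 2 <= l <= 0)%R -> (c * l <= Rabs c * ln 2)%R).
{ intros c l Hl. pose proof (Rle_abs (- c)) as Hc. rewrite Rabs_Ropp in Hc.
  pose proof (Rabs_pos c).
  apply Rle_trans with (Rabs c * - l)%R. nra.
  apply Rmult_le_compat_l; lra. }
assert (0 <= Rabs al * ln 2)%R by (apply Rmult_le_pos; lra).
assert (0 <= Rabs be * ln 2)%R by (apply Rmult_le_pos; lra).
destruct (Rle_dec t (1 / 2)) as [Hth|Hth].
- apply Rle_trans with (exp ((Rabs al + Rabs be) * ln 2 + al * ln t)); [|lra].
  apply exp_le_exp.
  assert (be * ln (1 - t) <= Rabs be * ln 2)%R
    by (apply Hmul; split; [apply Hln |]; lra).
  lra.
- apply Rle_trans with (exp ((Rabs al + Rabs be) * ln 2 + be * ln (1 - t))); [|lra].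
  apply exp_le_exp.
  assert (al * ln t <= Rabs al * ln 2)%R
    by (apply Hmul; split; [apply Hln |]; lra).
  lra.
Qed.

Lemma filterlim_exp_ln_0 (al : R) : (0 < al)%R ->
  filterlim (fun t => exp (al * ln t)) (at_right 0) (locally 0%R).
Proof.
intros Hal. eapply filterlim_comp. 2: exact is_lim_exp_m.
eapply filterlim_comp. exact is_lim_ln_0.
assert (H := filterlim_Rbar_mult_l al m_infty).
rewrite (is_Rbar_mult_unique al m_infty m_infty) in H. exact H.
apply is_Rbar_mult_sym, is_Rbar_mult_m_infty_pos. exact Hal.
Qed.

Lemma filterlim_1_minus_left : filterlim (fun t => 1 - t)%R (at_left 1) (at_right 0).
Proof.
intros P [e He]. exists e. intros t Ht Ht1. apply He.
- change (Rabs (1 - t - 0) < e)%R. change (Rabs (t - 1) < e)%R in Ht.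
  now replace (1 - t - 0)%R with (- (t - 1))%R by ring; rewrite Rabs_Ropp.
- lra.
Qed.

Lemma filterlim_1_minus_right : filterlim (fun t => 1 - t)%R (at_right 0) (at_left 1).
Proof.
intros P [e He]. exists e. intros t Ht Ht1. apply He.
- change (Rabs (1 - t - 1) < e)%R. change (Rabs (t - 0) < e)%R in Ht.
  replace (1 - t - 1)%R with (- (t - 0))%R by ring. now rewrite Rabs_Ropp.
- lra.
Qed.

Lemma beta_kernel_succ_l (p q : R) (x y : C) (t : R) : (0 < t)%R ->
  beta_kernel p q (x + 1) y t = t * beta_kernel p q x y t.
Proof.
intros Ht. rewrite !beta_kernel_Cexp.
replace ((x + 1) * ln t + y * ln (1 - t) + RtoC (- (p / t) - q / (1 - t)))
  with (ln t + (x * ln t + y * ln (1 - t) + RtoC (- (p / t) - q / (1 - t)))) by ring.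
rewrite Cexp_plus. f_equal. unfold Cexp; simpl. rewrite exp_ln, cos_0, sin_0 by exact Ht.
apply injective_projections; simpl; ring.
Qed.

Lemma beta_kernel_succ_r (p q : R) (x y : C) (t : R) : (t < 1)%R ->
  beta_kernel p q x (y + 1) t = (1 - t)%R * beta_kernel p q x y t.
Proof.
intros Ht. rewrite !beta_kernel_Cexp.
replace (x * ln t + (y + 1) * ln (1 - t) + RtoC (- (p / t) - q / (1 - t)))
  with (ln (1 - t) + (x * ln t + y * ln (1 - t) + RtoC (- (p / t) - q / (1 - t))))
  by ring.
rewrite Cexp_plus. f_equal. unfold Cexp; simpl.
rewrite exp_ln, cos_0, sin_0 by lra.
apply injective_projections; simpl; ring.
Qed.

(** The integral over ]0, 1[ of the majorant in [beta_modulus_le] for the exponents [al - 1] and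
    [be - 1]. *)
Definition beta_bound (al be : R) : R :=
  (exp ((Rabs (al - 1) + Rabs (be - 1)) * ln 2) * (/ al + / be))%R.

Lemma filterlim_Rplus {F : (R -> Prop) -> Prop} {FF : Filter F} (f g : R -> R) (a b : R) :
  filterlim f F (locally a) -> filterlim g F (locally b) ->
  filterlim (fun t => f t + g t)%R F (locally (a + b)%R).
Proof.
intros Hf Hg. eapply filterlim_comp_2. exact Hf. exact Hg.
apply (filterlim_plus (K := R_AbsRing) (V := R_NormedModule)).
Qed.

Lemma filterlim_Rscal {F : (R -> Prop) -> Prop} {FF : Filter F} (f : R -> R) (c a : R) :
  filterlim f F (locally a) -> filterlim (fun t => c * f t)%R F (locally (c * a)%R).
Proof.
intros Hf. eapply filterlim_comp. exact Hf.
apply (filterlim_scal_r (K := R_AbsRing) (V := R_NormedModule)).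
Qed.

Lemma filterlim_exp_ln_1 (be : R) :
  filterlim (fun t => exp (be * ln t)) (at_left 1) (locally 1%R).
Proof.
replace 1%R with (exp (be * ln 1)) at 2 by (rewrite ln_1, Rmult_0_r; apply exp_0).
apply (filterlim_filter_le_1 (F := locally 1%R) _ (filter_le_within _)).
apply (ex_derive_continuous (K := R_AbsRing) (V := R_NormedModule)
  (fun t => exp (be * ln t))).
auto_derive. lra.
Qed.

(** The majorant [g] has the primitive [G], with finite limits at 0 and 1 since [al] and [be] are
    positive. Keeping [al] apart from [Re x] makes the bound uniform over all [x] with
    [al <= Re x]. *)
Lemma is_RInt_gen_beta_kernel (p q : R) (x y : C) (al : R) :
  (0 <= p)%R -> (0 <= q)%R -> (0 < al <= Re x)%R -> (0 < Re y)%R ->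
  exists l : C,
    is_RInt_gen (V := C_R_NormedModule) (beta_kernel p q (x - 1) (y - 1))
      (at_right 0%R) (at_left 1%R) l /\ (Cmod l <= beta_bound al (Re y))%R.
Proof.
intros Hp Hq Hx Hy.
set (be := Re y) in *.
set (K := exp ((Rabs (al - 1) + Rabs (be - 1)) * ln 2)).
set (g := fun t => (K * (exp ((al - 1) * ln t) + exp ((be - 1) * ln (1 - t))))%R).
set (G := fun t => (K * (/ al * exp (al * ln t) + - / be * exp (be * ln (1 - t))))%R).
(* Differentiating [G] produces s^c / s, to be matched with the s^(c-1) in [g]. *)
assert (Hpow : forall c s, (0 < s)%R -> (exp (c * ln s) = s * exp ((c - 1) * ln s))%R).
{ intros c s Hs. replace (c * ln s)%R with (ln s + (c - 1) * ln s)%R by ring.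
  now rewrite exp_plus, exp_ln. }
destruct (is_RInt_gen_dominated (V := C_R_CompleteNormedModule) 0 1 Rlt_0_1
  (beta_kernel p q (x - 1) (y - 1)) G g
  (K * (/ al * 0 + - / be * 1))%R (K * (/ al * 1 + - / be * 0))%R) as [l [Hl Hn]].
- intros t Ht. now apply continuous_beta_kernel.
- intros t Ht. rewrite <- Cmod_norm, Cmod_beta_kernel.
  replace be with (Re y) by reflexivity.
  eapply Rle_trans. apply (beta_modulus_le p q _ _ (al - 1)); try assumption.
  + unfold Re; simpl. unfold Re in Hx. lra.
  + unfold g, K, be, Re, Cminus; simpl. right. reflexivity.
- intros t Ht. unfold G, g. auto_derive. lra.
  unfold Rminus in *. rewrite (Hpow al t), (Hpow be (1 + - t)%R) by lra.
  unfold Rminus. field. lra.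
- intros t Ht. apply (ex_derive_continuous (K := R_AbsRing) (V := R_NormedModule) g).
  unfold g. auto_derive. lra.
- apply filterlim_Rscal, filterlim_Rplus; apply filterlim_Rscal.
  + apply filterlim_exp_ln_0. lra.
  + eapply (filterlim_comp _ _ _ (fun t => 1 - t)%R (fun t => exp (_ * ln t))).
    apply filterlim_1_minus_right. apply filterlim_exp_ln_1.
- apply filterlim_Rscal, filterlim_Rplus; apply filterlim_Rscal.
  + apply filterlim_exp_ln_1.
  + eapply (filterlim_comp _ _ _ (fun t => 1 - t)%R (fun t => exp (_ * ln t))).
    apply filterlim_1_minus_left.
    now apply filterlim_exp_ln_0.
- exists l. split. exact Hl. rewrite Cmod_norm.
  eapply Rle_trans. exact Hn. right. unfold beta_bound. fold K. ring.
Qed.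

Lemma ext_beta_RInt_gen (p q : R) (x y : C) (al : R) :
  (0 <= p)%R -> (0 <= q)%R -> (0 < al <= Re x)%R -> (0 < Re y)%R ->
  is_RInt_gen (V := C_R_NormedModule) (beta_kernel p q (x - 1) (y - 1))
    (at_right 0%R) (at_left 1%R) (ext_beta p q x y)
  /\ (Cmod (ext_beta p q x y) <= beta_bound al (Re y))%R.
Proof.
intros Hp Hq Hx Hy.
destruct (is_RInt_gen_beta_kernel p q x y al Hp Hq Hx Hy) as [l [Hl Hn]].
replace (ext_beta p q x y) with l. now split.
symmetry. apply (is_RInt_gen_unique (V := C_R_CompleteNormedModule)).
apply (is_RInt_gen_ext (V := C_R_NormedModule)) with (2 := Hl).
apply (Filter_prod _ _ _ _ _ (at_right_Ioo 0 1 Rlt_0_1) (at_left_Ioo 0 1 Rlt_0_1)).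
intros s t Hs Ht r Hr. symmetry. apply ext_beta_integrand.
apply (Rmin_Rmax_Ioo 0 1 s t r Hs Ht). simpl in Hr. lra.
Qed.

(** The integrands agree at every real [t], even at 0 and 1, because a zero numerator makes each
    quotient 0 there too. *)
Lemma beta_ext_beta (x y : C) : beta x y = ext_beta 0 0 x y.
Proof.
unfold beta, ext_beta. f_equal. apply functional_extensionality. intros t.
replace (- (0 / t) - 0 / (1 - t))%R with 0%R by (unfold Rdiv; ring).
rewrite exp_0. ring.
Qed.

(** * The recurrence of the classical beta function *)

Lemma filterlim_Cmod_0 {F : (R -> Prop) -> Prop} {FF : Filter F} (f : R -> C) (g : R -> R) :
  F (fun t => Cmod (f t) <= g t)%R -> filterlim g F (locally 0%R) ->
  filterlim f F (locally (T := C_UniformSpace) (RtoC 0)).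
Proof.
intros Hfg Hg. apply filterlim_locally. intros eps.
assert (H := proj1 (filterlim_locally g 0%R) Hg eps).
generalize (filter_and _ _ Hfg H). apply filter_imp. intros t [H1 H2].
apply (C_NormedModule_mixin_compat1 (RtoC 0) (f t) eps).
change (Cmod (f t - 0) < eps)%R. replace (f t - 0) with (f t) by ring.
eapply Rle_lt_trans. exact H1.
change (Rabs (g t - 0) < eps)%R in H2. apply Rabs_def2 in H2. lra.
Qed.

Lemma beta_kernel_lim_0 (x y : C) : (0 < Re x)%R -> (0 <= Re y)%R ->
  filterlim (beta_kernel 0 0 x y) (at_right 0) (locally (T := C_UniformSpace) (RtoC 0)).
Proof.
intros Hx Hy.
apply filterlim_Cmod_0 with (fun t => exp (Re x * ln t)).
- generalize (at_right_Ioo 0 1 Rlt_0_1). apply filter_imp. intros t Ht.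
  rewrite Cmod_beta_kernel. apply exp_le_exp.
  assert (ln (1 - t) < 0)%R by (rewrite <- ln_1; apply ln_increasing; lra).
  unfold Rdiv. nra.
- now apply filterlim_exp_ln_0.
Qed.

Lemma beta_kernel_lim_1 (x y : C) : (0 <= Re x)%R -> (0 < Re y)%R ->
  filterlim (beta_kernel 0 0 x y) (at_left 1) (locally (T := C_UniformSpace) (RtoC 0)).
Proof.
intros Hx Hy.
apply filterlim_Cmod_0 with (fun t => exp (Re y * ln (1 - t))).
- generalize (at_left_Ioo 0 1 Rlt_0_1). apply filter_imp. intros t Ht.
  rewrite Cmod_beta_kernel. apply exp_le_exp.
  assert (ln t < 0)%R by (rewrite <- ln_1; apply ln_increasing; lra).
  unfold Rdiv. nra.
- eapply (filterlim_comp _ _ _ (fun t => 1 - t)%R (fun t => exp (_ * ln t))).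
    apply filterlim_1_minus_left. now apply filterlim_exp_ln_0.
Qed.

Lemma continuous_Cmult_l (c : C) (f : R -> C) (t : R) :
  continuous (T := R_UniformSpace) (U := C_UniformSpace) f t ->
  continuous (T := R_UniformSpace) (U := C_UniformSpace) (fun s => c * f s) t.
Proof.
intros H. eapply filterlim_comp. exact H.
exact (filterlim_scal_r (K := C_AbsRing) (V := C_NormedModule) c (f t)).
Qed.

(* Integrate the derivative of [t^x (1 - t)^y] over ]0, 1[. *)
Lemma beta_succ_l (x y : C) : (0 < Re x)%R -> (0 < Re y)%R ->
  (x + y) * beta (x + 1) y = x * beta x y.
Proof.
intros Hx Hy. rewrite !beta_ext_beta.
destruct (ext_beta_RInt_gen 0 0 x y (Re x)) as [H1 _]; try lra.
destruct (ext_beta_RInt_gen 0 0 (x + 1) y (Re x)) as [H2 _]; try lra.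
{ unfold Re; simpl. unfold Re in Hx. lra. }
assert (H := is_RInt_gen_minus (V := C_R_NormedModule) _ _ _ _
  (is_RInt_gen_Cmult x _ _ _ _ H1) (is_RInt_gen_Cmult (x + y) _ _ _ _ H2)).
(* This integrand, x t^(x-1) (1-t)^(y-1) - (x+y) t^x (1-t)^(y-1), is the derivative of t^x (1-t)^y,
   which tends to 0 at both ends. *)
assert (H0 : is_RInt_gen (V := C_R_NormedModule) (fun t => minus (G := C_R_NormedModule)
  (x * beta_kernel 0 0 (x - 1) (y - 1) t)
  ((x + y) * beta_kernel 0 0 (x + 1 - 1) (y - 1) t))
  (at_right 0%R) (at_left 1%R) (minus (G := C_R_NormedModule) (RtoC 0) (RtoC 0))).
{ apply (is_RInt_gen_derive_Ioo (V := C_R_CompleteNormedModule) 0 1 Rlt_0_1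
    (beta_kernel 0 0 x y)).
  - intros t Ht.
    replace (minus _ _) with ((x / t - y / (1 - t)%R
      + RtoC (0 / t ^ 2 - 0 / (1 - t) ^ 2)%R) * beta_kernel 0 0 x y t).
    now apply is_derive_beta_kernel.
    replace (x + 1 - 1) with (x - 1 + 1) by ring.
    rewrite beta_kernel_succ_l by lra.
    replace (beta_kernel 0 0 x y t) with
      (beta_kernel 0 0 ((x - 1) + 1) ((y - 1) + 1) t) by (f_equal; ring).
    rewrite beta_kernel_succ_l, beta_kernel_succ_r by lra.
    set (k := beta_kernel 0 0 (x - 1) (y - 1) t).
    change ((x / t - y / (1 - t)%R + RtoC (0 / t ^ 2 - 0 / (1 - t) ^ 2)%R)
      * (t * ((1 - t)%R * k)) = x * k - (x + y) * (t * k)).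
    replace (0 / t ^ 2 - 0 / (1 - t) ^ 2)%R with 0%R by (unfold Rdiv; ring).
    rewrite RtoC_minus. field. cbv beta. rewrite <- RtoC_minus.
    split; intros E; apply RtoC_inj in E; lra.
  - intros t Ht. apply (continuous_minus (K := R_AbsRing) (V := C_R_NormedModule));
      apply continuous_Cmult_l; now apply continuous_beta_kernel.
  - apply beta_kernel_lim_0; lra.
  - apply beta_kernel_lim_1; lra. }
assert (E := eq_trans (eq_sym
  (is_RInt_gen_unique (V := C_R_CompleteNormedModule) _ _ H))
  (is_RInt_gen_unique (V := C_R_CompleteNormedModule) _ _ H0)).
change (x * ext_beta 0 0 x y - (x + y) * ext_beta 0 0 (x + 1) y = 0 - 0) in E.
replace ((x + y) * ext_beta 0 0 (x + 1) y) with (x * ext_beta 0 0 x y -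
  (x * ext_beta 0 0 x y - (x + y) * ext_beta 0 0 (x + 1) y)) by ring.
rewrite E. ring.
Qed.

Lemma C_neq_0_of_Re (a : C) : (0 < Re a)%R -> a <> 0.
Proof. intros H E. rewrite E in H. simpl in H. lra. Qed.

Lemma pochhammer_neq_0 (a : C) (n : nat) : (0 < Re a)%R -> pochhammer a n <> 0.
Proof.
intros Ha. induction n as [|n IH]; simpl.
- intros E. apply RtoC_inj in E. lra.
- apply Cmult_neq_0. exact IH. apply C_neq_0_of_Re. simpl.
  generalize (pos_INR n). unfold Re in Ha. lra.
Qed.

(** Iterates [beta_succ_l]. For [x = b] and [y = c - b] it expresses the ratio of beta values as
    (b)_n / (c)_n, in a form free of division. *)
Lemma beta_shift_l (x y : C) (n : nat) : (0 < Re x)%R -> (0 < Re y)%R ->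
  pochhammer (x + y) n * beta (x + INR n) y = pochhammer x n * beta x y.
Proof.
intros Hx Hy. induction n as [|n IH].
- simpl. now replace (x + 0) with x by ring.
- pose proof (pos_INR n) as Hn.
  assert (H := beta_succ_l (x + INR n) y).
  rewrite S_INR, RtoC_plus. cbn [pochhammer].
  replace (x + (INR n + 1)) with (x + INR n + 1) by ring.
  replace (pochhammer (x + y) n * (x + y + INR n) * beta (x + INR n + 1) y)
    with (pochhammer (x + y) n * ((x + INR n + y) * beta (x + INR n + 1) y)) by ring.
  rewrite H.
  + transitivity ((x + INR n) * (pochhammer (x + y) n * beta (x + INR n) y)).
    ring. rewrite IH. ring.
  + simpl. unfold Re in Hx. lra.
  + exact Hy.
Qed.

(* Valid also at [b = 0], where both quotients are [0]; this spares a proof that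
   the beta function does not vanish. *)
Lemma Cdiv_cancel (k a b : C) : k <> 0 -> k * a / (k * b) = a / b.
Proof.
intros Hk. destruct (Ceq_dec b 0) as [->|Hb].
- rewrite Cmult_0_r.
  assert (H0 : / RtoC 0 = 0)
    by (apply injective_projections; simpl; unfold Rdiv; ring).
  unfold Cdiv. rewrite H0. ring.
- field. now split.
Qed.

(** * Derivatives of the confluent hypergeometric function *)

Section PhiDerivative.

Variables (p q : R) (b c : C).
Hypothesis Hp : (0 <= p)%R.
Hypothesis Hq : (0 <= q)%R.
Hypothesis Hb : (0 < Re b)%R.
Hypothesis Hbc : (Re b < Re c)%R.

Lemma Re_c_minus_b : (0 < Re (c - b))%R.
Proof. simpl. unfold Re in *. lra. Qed.

(** Adding [n] only raises the real part, so [al = Re b] gives one bound for all [n]. *)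
Lemma Phi_coef_bounded (n : nat) :
  (Cmod (ext_beta p q (b + INR n) (c - b) / beta b (c - b))
    <= beta_bound (Re b) (Re (c - b)) * Cmod (/ beta b (c - b)))%R.
Proof.
unfold Cdiv. rewrite Cmod_mult. apply Rmult_le_compat_r. apply Cmod_ge_0.
apply ext_beta_RInt_gen; try assumption; try apply Re_c_minus_b.
simpl. generalize (pos_INR n). unfold Re in *. lra.
Qed.

(** Shifting [b] and [c] together keeps [c - b] fixed, so both coefficients share their numerator;
    [beta_shift_l] relates the denominators. *)
Lemma Phi_shift_coef (n k : nat) :
  ext_beta p q (b + INR (n + k)) (c - b) / beta b (c - b) =
  pochhammer b n / pochhammer c n *
    (ext_beta p q (b + INR n + INR k) (c + INR n - (b + INR n))
      / beta (b + INR n) (c + INR n - (b + INR n))).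
Proof.
replace (c + INR n - (b + INR n)) with (c - b) by ring.
rewrite plus_INR, RtoC_plus, Cplus_assoc.
assert (H := beta_shift_l b (c - b) n Hb Re_c_minus_b).
replace (b + (c - b)) with c in H by ring.
set (e := ext_beta _ _ _ _).
assert (H1 : pochhammer b n <> 0) by now apply pochhammer_neq_0.
assert (H2 : pochhammer c n <> 0) by (apply pochhammer_neq_0; lra).
(* Both fractions are brought to the denominator [pochhammer c n * beta (b + INR n) (c - b)]. *)
rewrite <- (Cdiv_cancel (pochhammer b n) e (beta b (c - b))) by exact H1.
rewrite <- H.
rewrite <- (Cdiv_cancel (pochhammer c n) e (beta (b + INR n) (c - b))) by exact H2.
unfold Cdiv. rewrite (Cmult_comm (pochhammer c n) e).
transitivity (pochhammer b n * e * / (pochhammer c n * beta (b + INR n) (c - b))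
  * (pochhammer c n * / pochhammer c n)); [|ring].
rewrite Cinv_r by exact H2. ring.
Qed.

End PhiDerivative.

Lemma is_C_derive_n_Phi (p q : R) (b c : C) (n : nat) (z : C) :
  (0 <= p)%R -> (0 <= q)%R -> (0 < Re b < Re c)%R ->
  is_C_derive_n (Phi p q b c) n z
    (pochhammer b n / pochhammer c n * Phi p q (b + INR n) (c + INR n) z).
Proof.
intros Hp Hq [Hb Hbc].
assert (H := is_C_derive_n_exp_gen_fun _ _ n z (Phi_coef_bounded p q b c Hp Hq Hb Hbc)).
pose proof (pos_INR n) as Hn.
(* [CSeries] is specified only for convergent series, so the constant factor enters the sum through
   [is_series]. *)
assert (Hs := is_series_exp_gen_fun _ _ z (Phi_coef_bounded p q (b + INR n) (c + INR n)
  Hp Hq ltac:(unfold Re in *; simpl; lra) ltac:(unfold Re in *; simpl; lra))).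
apply (is_series_scal (K := C_AbsRing) (V := C_NormedModule)
  (pochhammer b n / pochhammer c n)) in Hs.
apply CSeries_unique in Hs.
change (Phi p q (b + INR n) (c + INR n) z) with
  (exp_gen_fun (fun k => ext_beta p q (b + INR n + INR k) (c + INR n - (b + INR n))
    / beta (b + INR n) (c + INR n - (b + INR n))) z).
match goal with |- is_C_derive_n _ _ _ ?v =>
  replace v with (exp_gen_fun (fun k => ext_beta p q (b + INR (n + k)) (c - b)
    / beta b (c - b)) z) end.
- exact H.
- rewrite <- Hs at 1. unfold exp_gen_fun at 1. f_equal. apply functional_extensionality.
  intros k. rewrite (Phi_shift_coef p q b c Hb Hbc). symmetry. apply Cmult_assoc.
Qed.

(** * The Whittaker function *)

Theorem theorem2p5 (p q : R) (lambda rho z : C) (n : nat)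
    (hp : (0 <= p)%R) (hq : (0 <= q)%R)
    (hrho : (Re rho > - (1 / 2))%R)
    (hplus : (Re (rho + lambda) > - (1 / 2))%R)
    (hminus : (Re (rho - lambda) > - (1 / 2))%R)
    (hz : slit_plane z) :
  is_C_derive_n
    (fun w : C => Cexp (w / 2) * Cpower w (- rho - 1 / 2) * Whittaker p q lambda rho w)
    n z
    (pochhammer (rho - lambda + 1 / 2) n / pochhammer (2 * rho + 1) n *
     Cexp (z / 2) * Cpower z (- rho - INR n / 2 - 1 / 2) *
     Whittaker p q (lambda - INR n / 2) (rho + INR n / 2) z).
Proof.
(* Stated for arbitrary parameters, to serve both the differentiated function and the right-hand
   side, where [r = rho + n/2] and [l = lambda - n/2]. *)
assert (Hcancel : forall (w r l : C),
  Cexp (w / 2) * Cpower w (- r - 1 / 2) * Whittaker p q l r w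
    = Phi p q (r - l + 1 / 2) (2 * r + 1) w).
{ intros w r l. unfold Whittaker.
  set (phi := Phi _ _ _ _ _).
  transitivity ((Cexp (w / 2) * Cexp (- w / 2))
    * (Cpower w (- r - 1 / 2) * Cpower w (r + 1 / 2)) * phi). ring.
  rewrite <- Cexp_plus, <- Cpower_plus.
  replace (w / 2 + - w / 2) with (RtoC 0) by (unfold Cdiv; ring).
  replace (- r - 1 / 2 + (r + 1 / 2)) with (RtoC 0) by ring.
  rewrite Cexp_0, Cpower_0. ring. }
assert (H2 : RtoC 2 <> 0) by (intros E; apply RtoC_inj in E; lra).
replace (fun w : C => _) with (Phi p q (rho - lambda + 1 / 2) (2 * rho + 1))
  by (apply functional_extensionality; intros w; now rewrite Hcancel).
replace (- rho - INR n / 2 - 1 / 2) with (- (rho + INR n / 2) - 1 / 2) by ring.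
rewrite <- !Cmult_assoc, (Cmult_assoc (Cexp _)), Hcancel.
(* The opposite half-shifts of [rho] and [lambda] raise both parameters of [Phi] by exactly [n]. *)
replace (rho + INR n / 2 - (lambda - INR n / 2) + 1 / 2)
  with (rho - lambda + 1 / 2 + INR n) by (field; exact H2).
replace (2 * (rho + INR n / 2) + 1) with (2 * rho + 1 + INR n) by (field; exact H2).
apply is_C_derive_n_Phi; try assumption.
(* For b = rho - lambda + 1/2 and c = 2 rho + 1, [hminus] says that Re b > 0 and [hplus] that Re (c
   - b) > 0. *)
assert (Eb : Re (rho - lambda + 1 / 2) = (Re rho - Re lambda + 1 / 2)%R)
  by (unfold Re; simpl; field).
assert (Ec : Re (2 * rho + 1) = (2 * Re rho + 1)%R) by (unfold Re; simpl; ring).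
assert (E1 : Re (rho + lambda) = (Re rho + Re lambda)%R) by reflexivity.
assert (E2 : Re (rho - lambda) = (Re rho - Re lambda)%R) by reflexivity.
rewrite Eb, Ec. lra.
Qed.
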